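(* Let $n \ge 2$. In the $n$-player collaboration chain started from the state in which all $n$ players are on different teams, the expected number of time steps until the final (absorbing) state, in which all $n$ players are on the same team, is first reached equals $(n-1)^2$.
   Context: The chain: there are $n$ players, each initially on a different team (so $n$ teams of size 1). At each time step an ordered pair (winner, loser) of distinct players is chosen uniformly at random among the $n(n-1)$ such pairs, independently of the past; the loser leaves his or her team and joins the winner's team (nothing changes if they are already on the same team). The state of the system is the partition of $n$ given by the multiset of sizes of the nonempty teams. The state with a single team of size $n$ is absorbing. *)

(* Defs.v *)
From HB Require Import structures.
From mathcomp Require Import all_boot all_order all_algebra.
From mathcomp Require Import finmap.
From mathcomp Require Import all_classical all_reals all_analysis.

Set Implicit Arguments.
Unset Strict Implicit.
Unset Printing Implicit Defensive.

Import Order.TTheory GRing.Theory Num.Theory.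

Local Open Scope classical_set_scope.
Local Open Scope ring_scope.

(* Ordered pairs (winner, loser) of distinct players. *)
Definition game (n : nat) := {p : 'I_n * 'I_n | p.1 != p.2}.
Definition winner n (p : game n) : 'I_n := (val p).1.
Definition loser n (p : game n) : 'I_n := (val p).2.

(* [a i] is the label of the team of player [i]; a label carried by no player
   stands for a team that has become empty. *)
Definition teams (n : nat) := {ffun 'I_n -> 'I_n}.

Definition initial_teams n : teams n := [ffun i => i].

Definition play n (a : teams n) (p : game n) : teams n :=
  [ffun i => if i == loser p then a (winner p) else a i].

Fixpoint teams_at n (g : nat -> game n) (t : nat) : teams n :=
  if t is t'.+1 then play (teams_at g t') (g t') else initial_teams n.

Definition team_size n (a : teams n) (k : 'I_n) : nat :=
  #|[set i : 'I_n | a i == k]%SET|.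

(* Partitions of [n] are represented by their weakly decreasing lists of
   parts, so that equality of lists is equality of multisets. *)
Definition state n (a : teams n) : seq nat :=
  sort geq [seq m <- [seq team_size a k | k <- enum 'I_n] | (0 < m)%N].

Lemma state_initial n : state (initial_teams n) = nseq n 1%N.
Proof.
have sz k : team_size (initial_teams n) k = 1%N.
  rewrite /team_size -(cards1 k); apply: eq_card => i.
  by rewrite !inE ffunE.
rewrite /state (eq_map sz).
have -> : [seq 1%N | _ <- enum 'I_n] = nseq n 1%N.
  rewrite -[in RHS](size_enum_ord n).
  by elim: (enum _) => //= x s ->.
have -> : [seq m <- nseq n 1%N | (0 < m)%N] = nseq n 1%N.
  by apply/all_filterP; rewrite all_nseq orbT.
apply: sorted_sort; first by move=> x y z; rewrite /geq /= => h1 h2; apply: leq_trans h2 h1.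
by elim: n {sz} => [|[|n] IH].
Qed.

(* First time at which all players are on the same team, [+oo] if never. *)
Definition absorption_time (R : realType) n (g : nat -> game n) : \bar R :=
  ereal_inf [set (t%:R)%:E | t in [set t : nat | state (teams_at g t) = [:: n]]].

Section RandomGames.
Context d (T : measurableType d) (R : realType) (P : probability T R).

(* Mutual independence of a sequence of random variables with values in a type
   [G] equipped with the discrete sigma-algebra. *)
Definition mutually_independent (G : Type) (X : nat -> T -> G) : Prop :=
  forall (I : {fset nat}) (B : nat -> set G),
    P (\bigcap_(t in [set` I]) (X t @^-1` B t)) =
    (\prod_(t <- I) P (X t @^-1` B t))%E.

Definition uniform_games n (X : nat -> T -> game n) : Prop :=
  [/\ forall t (B : set (game n)), measurable (X t @^-1` B),
      forall t (p : game n),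
        P (X t @^-1` [set p]) = ((n * (n - 1))%N%:R^-1)%:E
    & mutually_independent X].

End RandomGames.

(* Main.v *)
(* Let [K] be the transition operator. A team of size [s] grows by one with
   probability [s(n-s)/(n(n-1))] and shrinks by one with the same probability.
   Hence, for a function [S] with [S 0 = S 1 = 0] and second difference
   [1/(n-s)] at every [1 <= s < n], the potential
   [h a = (n-1) (S n - \sum_k S (size of team k))] satisfies [K h = h - 1] off
   the absorbing states and vanishes on them. Telescoping gives
   [\sum_(s < t) Pr(not absorbed at time s) = h(start) - K^t h (start)].
   As [h] is bounded by a multiple of the indicator of non-absorption, the sums
   are bounded, so the probabilities tend to 0, and so does [K^t h (start)].
   The expected absorption time is therefore
   [h(start) = (n-1) S n = (n-1)^2]. *)

Require Import Defs.
From HB Require Import structures.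
From mathcomp Require Import all_boot all_order all_algebra.
From mathcomp Require Import finmap.
From mathcomp Require Import all_classical all_reals all_analysis.
From mathcomp Require Import measurable_realfun.
From mathcomp Require Import ring zify.

Set Implicit Arguments.
Unset Strict Implicit.
Unset Printing Implicit Defensive.

Import Order.TTheory GRing.Theory Num.Theory.
Import numFieldNormedType.Exports.
Local Open Scope classical_set_scope.
Local Open Scope ring_scope.

(** * Absorbing states, and team sizes after one game *)

Definition merged n (a : teams n) : bool := state a == [:: n].

Lemma team_sizeP n (a : teams n) (k : 'I_n) :
  reflect (forall i, a i = k) (team_size a k == n).
Proof.
rewrite /team_size -[X in _ == X]card_ord -cardsT.
apply: (iffP idP) => [/eqP ak i|ak]; last first.
  by rewrite (_ : [set i | a i == k]%SET = finset.setT) //;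
    apply/setP => i; rewrite !inE ak eqxx.
have : [set i | a i == k]%SET = [set: 'I_n]%SET.
  by apply/eqP; rewrite eqEcard finset.subsetT ak leqnn.
by move=> /setP /(_ i); rewrite !inE => /eqP.
Qed.

Lemma mergedP n (a : teams n) (n_gt0 : (0 < n)%N) :
  reflect (exists k, forall i, a i = k) (merged a).
Proof.
apply: (iffP eqP) => [sa|[k ak]].
  have : n \in state a by rewrite sa inE.
  rewrite mem_sort mem_filter => /andP[_ /mapP[k _ nk]].
  by exists k; apply/team_sizeP/eqP.
have sk l : team_size a l = (if l == k then n else 0)%N.
  case: eqVneq => [->|lk]; first by apply/eqP/team_sizeP.
  apply/eqP; rewrite cards_eq0; apply/eqP/setP => i.
  by rewrite !inE ak eq_sym (negbTE lk).
(* Only the common label [k] has positive size, so the filter leaves a single part. *)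
rewrite /state filter_map (@eq_filter _ _ (pred1 k)); last first.
  by move=> l /=; rewrite sk; case: eqVneq.
rewrite filter_pred1_uniq ?enum_uniq ?mem_enum //=.
by rewrite sk eqxx /sort.
Qed.

Lemma merged_play n (a : teams n) p :
  (0 < n)%N -> merged a -> merged (play a p).
Proof.
move=> n_gt0 /(mergedP _ n_gt0)[k ak]; apply/mergedP => //.
by exists k => i; rewrite ffunE; case: ifP.
Qed.

Lemma sum_team_size n (a : teams n) : (\sum_k team_size a k = n)%N.
Proof.
rewrite -[RHS]card_ord -sum1_card [RHS](partition_big a predT) //=.
by apply: eq_bigr => k _; rewrite /team_size -sum1_card;
  apply: eq_bigl => i; rewrite inE.
Qed.

Lemma team_size_le n (a : teams n) k : (team_size a k <= n)%N.
Proof. by rewrite -[leqRHS]card_ord max_card. Qed.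

(** The additive form avoids truncated subtraction and also covers a game between teammates. *)
Lemma team_size_play n (a : teams n) (p : game n) k :
  (team_size (play a p) k + (a (loser p) == k) =
   team_size a k + (a (winner p) == k))%N.
Proof.
rewrite /team_size -!sum1_card !(big_mkcond (fun i => i \in _)) /=.
rewrite (bigD1 (loser p)) // [in RHS](bigD1 (loser p)) //=.
rewrite !inE ffunE eqxx.
under eq_bigr => i il do rewrite inE ffunE (negbTE il).
under [in RHS]eq_bigr => i il do rewrite inE.
by do 2!case: (_ == k); lia.
Qed.

(** * The transition operator and the potential *)

Section Kernel.
Variables (R : realType) (n : nat).
Implicit Types (phi psi : teams n -> R) (a : teams n).

(** The operator [K] of the overview, acting on functions of labelled teams rather than of
    partitions, so that one step is a plain average over games. *)
Definition step phi a : R :=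
  ((n * (n - 1))%N%:R)^-1 * \sum_(p : game n) phi (play a p).

Lemma stepB phi psi :
  step (fun a => phi a - psi a) = (fun a => step phi a - step psi a).
Proof. by apply/funext => a; rewrite /step sumrB mulrBr. Qed.

Lemma iter_stepB t phi psi : iter t step (fun a => phi a - psi a) =
  (fun a => iter t step phi a - iter t step psi a).
Proof. by elim: t => //= t ->; rewrite stepB. Qed.

(** Averaging with nonnegative weights preserves pointwise bounds. Used with [psi] equal to
    [unmerged] and to the constant 1. *)
Lemma iter_step_norm t phi psi (C : R) :
  (forall a, `|phi a| <= C * psi a) ->
  forall a, `|iter t step phi a| <= C * iter t step psi a.
Proof.
move=> H; elim: t => //= t IH a; rewrite /step normrM ger0_norm ?invr_ge0 //.
rewrite mulrCA ler_wpM2l ?invr_ge0 // (le_trans (ler_norm_sum _ _ _)) //.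
by rewrite mulr_sumr ler_sum.
Qed.

Lemma iter_step_ge0 t phi :
  (forall a, 0 <= phi a) -> forall a, 0 <= iter t step phi a.
Proof.
move=> H; elim: t => //= t IH a.
by rewrite mulr_ge0 ?invr_ge0 // sumr_ge0.
Qed.

Definition unmerged a : R := (~~ merged a)%:R.

(** The first difference of [S] at [m]; for [m < n] it is a difference of harmonic numbers,
    [H_(n-1) - H_(n-1-m)]. *)
Definition harm (m : nat) : R := \sum_(1 <= j < m.+1) (n - j)%N%:R^-1.
Definition size_potential (m : nat) : R := \sum_(0 <= i < m) harm i.
(** The inner [n - 1] is the value [S n], see [size_potential_n]. *)
Definition potential a : R :=
  (n - 1)%N%:R * ((n - 1)%N%:R - \sum_k size_potential (team_size a k)).

Lemma size_potential0 : size_potential 0 = 0.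
Proof. by rewrite /size_potential big_geq. Qed.

Lemma size_potentialS m : size_potential m.+1 = size_potential m + harm m.
Proof. by rewrite /size_potential big_nat_recr. Qed.

Lemma harmS m : harm m.+1 = harm m + (n - m.+1)%N%:R^-1.
Proof. by rewrite /harm big_nat_recr. Qed.

(** Exchanging the two sums gives the sum over [1 <= j <= m] of [(m+1-j)/(n-j) = 1 - (n-m-1)/(n-j)].
    At [m = n - 1] the harmonic term disappears, which yields [S n]. *)
Lemma size_potentialE m : (m < n)%N ->
  size_potential m.+1 = m%:R - (n - m.+1)%N%:R * harm m.
Proof.
elim: m => [|m IH] mn.
  by rewrite size_potentialS size_potential0 /harm big_geq // mulr0 addr0 subr0.
rewrite size_potentialS IH 1?ltnW // harmS.
have -> : (n - m.+1 = (n - m.+2).+1)%N by lia.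
rewrite -!natr1; field.
by rewrite natr1 pnatr_eq0.
Qed.

Lemma size_potential_n : (0 < n)%N -> size_potential n = (n - 1)%N%:R.
Proof.
move=> n0; rewrite -[in LHS](prednK n0) size_potentialE; last by rewrite prednK.
by rewrite prednK // subnn mul0r subr0 subn1.
Qed.

Lemma potential_initial : potential (initial_teams n) = ((n - 1) ^ 2)%N%:R.
Proof.
rewrite /potential big1 ?subr0 -?natrM // => k _.
have -> : team_size (initial_teams n) k = 1%N.
  rewrite /team_size -(cards1 k); apply: eq_card => i.
  by rewrite !inE ffunE.
by rewrite size_potentialS size_potential0 /harm big_geq // addr0.
Qed.

Lemma potential_merged a : (0 < n)%N -> merged a -> potential a = 0.
Proof.
move=> n0 /(mergedP _ n0)[k ak]; rewrite /potential (bigD1 k) //=.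
have /team_sizeP/eqP -> := ak.
rewrite size_potential_n // big1 ?addr0 ?subrr ?mulr0 // => l lk.
suff -> : team_size a l = 0%N by rewrite size_potential0.
apply/eqP; rewrite cards_eq0; apply/eqP/setP => i.
by rewrite !inE ak eq_sym (negbTE lk).
Qed.

Lemma sum_gameE (F : 'I_n -> 'I_n -> R) : (forall i, F i i = 0) ->
  \sum_(p : game n) F (winner p) (loser p) = \sum_i \sum_j F i j.
Proof.
move=> F0; rewrite pair_big /= (bigID (fun p : 'I_n * 'I_n => p.1 != p.2)) /=.
rewrite [X in _ = _ + X]big1 ?addr0; last by move=> [i j] /= /negbNE/eqP ->.
by rewrite (big_sub (fun p : 'I_n * 'I_n => p.1 != p.2) (fun p => F p.1 p.2)).
Qed.

(** With [s] the size of team [k], there are [s(n-s)] games that enlarge it and as many that shrink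
    it, so the sum is [s(n-s)] times the second difference [1/(n-s)] of [S]. *)
Lemma size_potential_play a k : (forall l, team_size a l != n) ->
  \sum_(p : game n) (size_potential (team_size (play a p) k) -
     size_potential (team_size a k)) = (team_size a k)%:R.
Proof.
move=> ne; set s := team_size a k.
pose up := size_potential s.+1 - size_potential s.
pose dn := size_potential s.-1 - size_potential s.
pose F (i j : 'I_n) := (a i == k)%:R * (a j != k)%:R * up +
                       (a i != k)%:R * (a j == k)%:R * dn.
rewrite (eq_bigr (fun p => F (winner p) (loser p))); last first.
  move=> p _; have := team_size_play a p k; rewrite -/s /F.
  move: (team_size (play a p) k) s @up @dn {F} => s' s up dn.
  case: (a (loser p) =P k) => _; case: (a (winner p) =P k) => _ /= E;
    rewrite ?(mul0r, mulr0, mul1r, addr0, add0r).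
  - by have -> : s' = s by [lia]; rewrite subrr.
  - by have -> : s' = s.-1 by lia.
  - by have -> : s' = s.+1 by lia.
  - by have -> : s' = s by [lia]; rewrite subrr.
rewrite sum_gameE; last first.
  by move=> i; rewrite /F; case: (_ == k); rewrite !(mul0r, mulr0, addr0).
have cs : \sum_i (a i == k)%:R = s%:R :> R.
  rewrite -natr_sum; congr _%:R.
  rewrite /s /team_size -sum1_card [RHS]big_mkcond /=.
  by apply: eq_bigr => i _; rewrite inE; case: (_ == k).
have cns : \sum_i (a i != k)%:R = (n - s)%N%:R :> R.
  rewrite natrB ?team_size_le // -cs -[X in X%:R - _]card_ord
    -sum1_card natr_sum -sumrB.
  by apply: eq_bigr => i _; case: (_ == k); rewrite ?subrr ?subr0.
have -> : \sum_i \sum_j F i j = s%:R * (n - s)%N%:R * (up + dn).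
  transitivity (\sum_i ((a i == k)%:R * (n - s)%N%:R * up +
                        (a i != k)%:R * s%:R * dn)).
    apply: eq_bigr => i _; rewrite big_split /= -!mulr_suml -!mulr_sumr.
    by rewrite cns cs.
  by rewrite big_split /= -!mulr_suml cs cns; ring.
(* For [s = 0], where [s.-1] is truncated, the factor [s] kills both sides. Otherwise [up + dn] is
   [harm s - harm s.-1]. *)
case E : s => [|s']; first by rewrite !mul0r.
have sn : (s < n)%N by rewrite ltn_neqAle ne team_size_le.
rewrite /up /dn E /= !size_potentialS harmS -E.
have : (n - s)%N%:R != 0 :> R by rewrite pnatr_eq0 subn_eq0 -ltnNge.
move=> ?; by field.
Qed.

Lemma sum_game_const (x : R) :
  \sum_(p : game n) x = (n * (n - 1))%N%:R * x.
Proof.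
(* The weight is 1 on every game and 0 on the diagonal, as [sum_gameE] requires. *)
rewrite (eq_bigr (fun p : game n => (winner p != loser p)%:R * x)); last first.
  by move=> p _; rewrite /winner /loser (valP p) mul1r.
rewrite (sum_gameE (F := fun i j => (i != j)%:R * x)); last first.
  by move=> i; rewrite eqxx mul0r.
under eq_bigr => i _.
  rewrite -mulr_suml -natr_sum -big_mkcond /= (eq_bigl (predC1 i)); last first.
    by move=> j; rewrite inE /= eq_sym.
  rewrite sum1_card cardC1 card_ord -subn1.
  over.
by rewrite sumr_const card_ord -[LHS]mulr_natl mulrA -natrM.
Qed.

(** Off the merged states, the contributions of the teams add up to the total size [n], so the
    summed change is [-(n-1)n], minus the number of games. Merged states stay merged and have
    potential 0. *)
Lemma step_potential a : (1 < n)%N ->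
  step potential a = potential a - unmerged a.
Proof.
move=> n1; have n0 := ltnW n1; rewrite /unmerged.
case: (boolP (merged a)) => am /=.
  rewrite /step big1 ?mulr0 ?subr0 ?potential_merged // => p _.
  by rewrite potential_merged // merged_play.
have ne l : team_size a l != n.
  by apply: contra am => /team_sizeP al; apply/mergedP => //; exists l.
have cne0 : ((n * (n - 1))%N%:R : R) != 0 by rewrite pnatr_eq0; lia.
have drift : \sum_(p : game n) (potential (play a p) - potential a) =
    - (n * (n - 1))%N%:R.
  under eq_bigr => p _.
    rewrite (_ : _ - _ = - (n - 1)%N%:R * \sum_k
      (size_potential (team_size (play a p) k) -
       size_potential (team_size a k))).
      over.
    by rewrite sumrB /potential; ring.
  rewrite -mulr_sumr exchange_big /= (eq_bigr (fun k => (team_size a k)%:R)).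
    by rewrite -natr_sum sum_team_size mulNr -natrM mulnC.
  by move=> k _; apply: size_potential_play.
apply: (mulfI cne0); rewrite /step mulVKf // mulrBr mulr1 -sum_game_const.
by rewrite -drift -big_split /=; apply: eq_bigr => p _; rewrite addrC subrK.
Qed.

Lemma sum_iter_step t a : (1 < n)%N ->
  \sum_(0 <= s < t) iter s step unmerged a =
  potential a - iter t step potential a.
Proof.
move=> n1; elim: t => [|t IH]; first by rewrite big_geq // subrr.
rewrite big_nat_recr //= IH -iterS iterSr.
rewrite (_ : step potential = fun a => potential a - unmerged a).
  by rewrite iter_stepB opprD opprK addrA.
by apply/funext => b; apply: step_potential.
Qed.

(** There are finitely many states, so the sum of all values of [|potential|] can serve as [C]. *)
Lemma potential_le_unmerged : (0 < n)%N -> exists2 C : R, 0 <= C &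
  forall a, `|potential a| <= C * unmerged a.
Proof.
move=> n0; exists (\sum_a `|potential a|); first by rewrite sumr_ge0.
move=> a; rewrite /unmerged.
case: (boolP (merged a)) => am /=.
  by rewrite mulr0 potential_merged ?normr0.
by rewrite mulr1 (bigD1 a) //= lerDl sumr_ge0.
Qed.

Lemma series_iter_step : (1 < n)%N ->
  (\sum_(0 <= t <oo) (iter t step unmerged (initial_teams n))%:E =
   (((n - 1) ^ 2)%N%:R)%:E)%E.
Proof.
move=> n1; have n0 := ltnW n1; have [C C0 leC] := potential_le_unmerged n0.
set u := fun t => iter t step unmerged (initial_teams n).
have u_ge0 t : 0 <= u t by apply: iter_step_ge0 => a; rewrite /unmerged ler0n.
have potle t : `|iter t step potential (initial_teams n)| <= C * u t.
  exact: iter_step_norm.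
have part t : series u t = potential (initial_teams n) -
    iter t step potential (initial_teams n).
  by rewrite /series /= sum_iter_step.
(* The weights sum to 1, so constants are fixed; this makes the bound [bnd] uniform in [t]. *)
have K1 t : iter t step (fun=> 1) = fun=> 1.
  elim: t => //= t ->; apply/funext => a.
  rewrite /step sum_game_const mulr1 mulVf //.
  by rewrite pnatr_eq0; lia.
have bnd t : `|iter t step potential (initial_teams n)| <= C.
  have := @iter_step_norm t potential (fun=> 1) C; rewrite K1 /= mulr1; apply => a.
  by rewrite (le_trans (leC a)) // ler_piMr // /unmerged; case: (~~ _).
have u_cvg : cvgn (series u).
  apply: nondecreasing_is_cvgn.
    by apply/nondecreasing_seqP => t; rewrite seriesSr lerDl.
  exists (`|potential (initial_teams n)| + C) => _ [t _ <-].
  by rewrite part (le_trans (ler_norm _)) // (le_trans (ler_normB _ _)) // lerD2l.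
have u0 : u @ \oo --> 0 by exact: cvg_series_cvg_0.
have pot0 : iter t step potential (initial_teams n) @[t --> \oo] --> 0.
  apply: norm_cvg0; apply: (@squeeze_cvgr _ _ _ _ (fun=> 0) (fun t => C * u t)).
  - by near=> t; rewrite normr_ge0 potle.
  - exact: cvg_cst.
  - by rewrite -(mulr0 C); apply: cvgMr.
apply/cvg_lim => //; rewrite (_ : (fun _ => _) = EFin \o series u); last first.
  by apply/funext => t /=; rewrite /series /= sumEFin.
apply: cvg_EFin; first by near=> t.
rewrite -potential_initial -[X in _ --> X]subr0.
rewrite (_ : fine \o _ = fun t => potential (initial_teams n) -
  iter t step potential (initial_teams n)); last by apply/funext => t /=.
by apply: cvgB => //; apply: cvg_cst.
Unshelve. all: by end_near. Qed.
End Kernel.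

(** * The absorption time as a sum of indicators *)

Lemma merged_at_mono n (g : nat -> game n) s t : (0 < n)%N -> (s <= t)%N ->
  merged (teams_at g s) -> merged (teams_at g t).
Proof.
move=> n0 /subnK <-; elim: (t - s)%N => //= r IH ms.
by apply: merged_play => //; apply: IH.
Qed.

(** Merging is permanent, so the unmerged times are exactly those before absorption, and counting
    them gives the first merged time. *)
Lemma absorption_timeE (R : realType) n (g : nat -> game n) : (0 < n)%N ->
  absorption_time R g = (\sum_(0 <= t <oo) (unmerged R (teams_at g t))%:E)%E.
Proof.
move=> n0; set v := fun t => (unmerged R (teams_at g t))%:E.
have v0 t : (0 <= v t)%E by rewrite lee_fin /unmerged ler0n.
have sum1 t : (forall s, (s < t)%N -> ~~ merged (teams_at g s)) ->
    (\sum_(0 <= s < t) v s = (t%:R)%:E)%E.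
  move=> H; rewrite sumEFin (eq_big_nat _ _ (F2 := fun=> 1)).
    by rewrite sumr_const_nat subn0.
  by move=> s /andP[_ st]; rewrite /unmerged H.
have split t : (\sum_(0 <= s <oo) v s =
    \sum_(0 <= s < t) v s + \sum_(t <= s <oo) v s)%E.
  by rewrite (nneseries_split 0 t).
have [ex|none] := pselect (exists t, merged (teams_at g t)).
  have [m mm mmin] := ex_minnP ex.
  rewrite (split m) sum1 => [|s sm]; last first.
    by apply/negP => /mmin; rewrite leqNgt sm.
  rewrite eseries0 ?adde0 => [|s ms _]; last first.
    by rewrite /v /unmerged (merged_at_mono n0 ms mm).
  apply/eqP; rewrite eq_le; apply/andP; split.
    by apply: ereal_inf_lbound; exists m => //; exact/eqP.
  apply: le_ereal_inf_tmp => _ [s /eqP /mmin ms <-].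
  by rewrite lee_fin ler_nat.
have um s : ~~ merged (teams_at g s) by apply/negP => ms; apply: none; exists s.
transitivity (+oo : \bar R)%E.
  rewrite /absorption_time (_ : [set t | _] = set0) ?image_set0 ?ereal_inf0 //.
  by apply/seteqP; split => // s /eqP ms; apply: none; exists s.
(* Without absorption the first [N] terms already sum to [N], which exceeds [A]. *)
apply/esym/eqyP => A A0.
have := archi_boundP (ltW A0); set N := Num.bound A => AN.
rewrite (split N) sum1 //.
apply: (@le_trans _ _ (N%:R)%:E); first by rewrite lee_fin ltW.
by rewrite leeDl // nneseries_ge0.
Qed.

(** * The law of the chain in terms of [step] *)

Section Law.
Context d (T : measurableType d) (R : realType) (P : probability T R).
Variables (n : nat) (X : nat -> T -> game n).
Hypothesis hX : uniform_games P X.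

Lemma measurable_teams_at t (B : set (teams n)) :
  measurable [set w | B (teams_at (X ^~ w) t)].
Proof.
have [mX _ _] := hX; elim: t B => [|t IH] B /=.
  have [b|b] := pselect (B (initial_teams n)).
    by rewrite (_ : [set _ | _] = setT) //; apply/seteqP; split.
  by rewrite (_ : [set _ | _] = set0) //; apply/seteqP; split.
rewrite (_ : [set _ | _] = \bigcup_p
  ([set w | B (play (teams_at (X ^~ w) t) p)] `&` X t @^-1` [set p])).
  apply: fin_bigcup_measurable => [|p _]; first exact: finite_finset.
   apply: measurableI => //.
  exact: (IH [set a | B (play a p)]).
apply/seteqP; split => w /=; first by exists (X t w).
by move=> [p _ [/= Bw Xp]]; rewrite Xp.
Qed.

Definition prefix_event k (g : nat -> game n) : set T :=
  \bigcap_(i in [set i | (i < k)%N]) X i @^-1` [set g i].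

Lemma probability_prefix k (g : nat -> game n) :
  P (prefix_event k g) = (((n * (n - 1))%N%:R)^-1 ^+ k)%:E.
Proof.
have [_ uX iX] := hX.
(* Independence is stated for finite sets of indices, so the prefix is recast as one. *)
have Ik : [set` [fset i in iota 0 k]%fset] = [set i | (i < k)%N].
  by apply/seteqP; split => i /=; rewrite !inE mem_iota.
rewrite /prefix_event -Ik (iX _ (fun i => [set g i])).
rewrite (eq_bigr _ (fun i _ => uX i (g i))).
rewrite (perm_big (iota 0 k)) /=; last first.
  by apply: uniq_perm; rewrite ?fset_uniq ?iota_uniq // => i; rewrite !inE.
by rewrite prodEFin big_const_seq count_predT size_iota iter_mulr_1.
Qed.

Lemma teams_at_prefix k g w :
  prefix_event k g w -> teams_at (X ^~ w) k = teams_at g k.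
Proof.
elim: k => //= k IH gw; rewrite IH => [|i ik]; last by apply: gw => /=; apply: ltnW.
by rewrite (gw k) //=.
Qed.

(* Conditioning on the first [k] games instead of on the state at time [k] turns
   the Markov property into a sum over the value of game [k]. *)
Lemma probability_prefix_teams_at t k g (B : set (teams n)) :
  P (prefix_event k g `&` [set w | B (teams_at (X ^~ w) (k + t))]) =
  (((n * (n - 1))%N%:R)^-1 ^+ k *
    iter t (@step R n) (fun a => (a \in B)%:R) (teams_at g k))%:E.
Proof.
have [mX _ _] := hX.
elim: t k g => [|t IH] k g.
  rewrite addn0 /=; case: (boolP (_ \in B)) => [/set_mem b|/negP b].
    rewrite mulr1 -(probability_prefix k g) (_ : _ `&` _ = prefix_event k g) //.
    by apply/seteqP; split => w => [[]//|gw];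
      split => //=; rewrite (teams_at_prefix gw).
  rewrite mulr0 (_ : _ `&` _ = set0) ?measure0 //.
  apply/seteqP; split => // w [gw /=]; rewrite (teams_at_prefix gw) => Bw.
  by apply: b; apply/mem_set.
(* Prescribing [p] as game [k] extends the prefix by one game and leaves the earlier ones alone. The
   event is then split over the value of game [k]. *)
pose upd p i := if i == k then p else g i.
have upd_k p : teams_at (upd p) k = teams_at g k.
  have : forall m, (m <= k)%N -> teams_at (upd p) m = teams_at g m.
    elim=> //= m IHm mk; rewrite IHm ?(ltnW mk) // /upd; case: eqP => // E.
    by rewrite E ltnn in mk.
  exact.
have prefix_upd p : prefix_event k.+1 (upd p) =
    prefix_event k g `&` X k @^-1` [set p].
  apply/seteqP; split => w.
    move=> H; split; last by have := H k (leqnn _); rewrite /upd eqxx.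
    move=> i /= ik; have := H i (ltnW ik); rewrite /upd; case: eqP => // E.
    by rewrite E ltnn in ik.
  move=> [H /= Xk] i /=; rewrite ltnS leq_eqVlt => /orP[/eqP ->|ik].
    by rewrite /upd eqxx.
  rewrite /upd; case: eqP => [E|_]; first by rewrite E ltnn in ik.
  exact: H.
rewrite (_ : _ `&` _ = \bigcup_p (prefix_event k.+1 (upd p) `&`
    [set w | B (teams_at (X ^~ w) (k.+1 + t))])); last first.
  rewrite addSnnS; apply/seteqP; split => w /=.
    by move=> [gw Bw]; exists (X k w) => //; rewrite prefix_upd.
  by move=> [p _ []]; rewrite prefix_upd => -[].
rewrite measure_fin_bigcup; [|exact: finite_finset| |].
- rewrite fsbig_finite /=; last exact: finite_finset.
  rewrite (perm_big (index_enum (game n))) /=; last first.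
    apply: uniq_perm; rewrite ?fset_uniq ?index_enum_uniq // => p.
    by rewrite mem_index_enum in_fset_set ?in_setT //; exact: finite_finset.
  rewrite (eq_bigr _ (fun p _ => IH k.+1 (upd p))) sumEFin.
  (* The additional factor from the longer prefix is the normalisation in [step]. *)
  congr _%:E; rewrite /step exprSr mulrA mulr_sumr; apply: eq_bigr => p _.
  by rewrite /= upd_k /upd eqxx.
- move=> p q _ _ [w [[+ _] [+ _]]]; rewrite !prefix_upd => -[_ /= <-] [_ /= <-].
  by [].
- move=> p _; apply: measurableI; last exact: measurable_teams_at.
  by apply: bigcap_measurableType => i _; apply: mX.
Qed.

End Law.

(** * Expectation of the absorption time *)

Theorem theorem8 (n : nat) (hn : (2 <= n)%N) (R : realType)
    (d : measure_display) (T : measurableType d) (P : probability T R)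
    (X : nat -> T -> game n) (hX : uniform_games P X) :
  (\int[P]_w absorption_time R (fun t => X t w) = (((n - 1) ^ 2)%N%:R)%:E)%E.
Proof.
have n0 := ltnW hn; rewrite -(series_iter_step R hn).
pose U t := [set w | ~~ merged (teams_at (X ^~ w) t)].
have mU t : measurable (U t).
  exact: (measurable_teams_at hX t [set a | ~~ merged a]).
have UE t w : (unmerged R (teams_at (X ^~ w) t))%:E = (\1_(U t) w)%:E.
  by rewrite indicE /unmerged; congr (_%:R)%:E; rewrite mem_setE.
rewrite (eq_integral (fun w => \sum_(0 <= t <oo) (\1_(U t) w)%:E)%E); last first.
  by move=> w _; rewrite absorption_timeE //; apply: eq_eseriesr => t _.
(* Nonnegative terms allow the integral and the series to be exchanged. *)
rewrite integral_nneseries //; last first.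
  by move=> t; apply/measurable_EFinP; exact: measurable_indic.
apply: eq_eseriesr => t _.
have ne : (Ordinal n0, Ordinal hn).1 != (Ordinal n0, Ordinal hn).2 by [].
(* Any sequence of games would do: the prefix has length 0, so its event is the whole space. *)
pose g : nat -> game n := fun=> exist _ (Ordinal n0, Ordinal hn) ne.
rewrite integral_indic // setIT.
have := probability_prefix_teams_at hX t 0 g [set a | ~~ merged a].
rewrite expr0 mul1r add0n /= (_ : _ `&` _ = U t); last first.
  by apply/seteqP; split => w => [[]//|Uw]; split.
move=> ->; congr (iter _ _ _ _)%:E; apply/funext => a.
by rewrite /unmerged mem_setE.
Qed.
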